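(* There is a $24\,CCZ\to4\,CCZ$ distillation protocol at distance $3$: the Klein quartic $Y^3Z+X^3Y+Z^3X=0$ has exactly $24$ points in the projective plane over $\mathbb F_8$; choose a representative $(X,Y,Z)\in\mathbb F_8^3$ of each, and let $G\in\mathbb F_8^{7\times24}$ have rows the evaluations at these representatives of $$XY^2Z^5,\quad X^2Y^5Z,\quad X^5YZ^2,\quad X^5Y^5Z^5\ \text{(logical rows)},\qquad X,\quad Y,\quad Z\ \text{(stabilizer rows)}.$$ Then $G$ has full rank and satisfies $$\sum_i(g_{a,i})^4(g_{b,i})^2g_{c,i}=\begin{cases}1&1\le a=b=c\le4\\0&\text{otherwise}\end{cases}\qquad(1\le a,b,c\le7);$$ consequently applying the norm gate $N$ ($CCZ$ up to Paulis) to each of the 24 physical qudits acts on the code as the logical $N^{\otimes4}$; and the $Z$-distance of the code is $3$.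
   Context: An $\mathbb F_8$-qudit, with basis $|\gamma\rangle$, $\gamma\in\mathbb F_8$, is identified with three qubits via an $\mathbb F_2$-basis of $\mathbb F_8$. The norm gate is $N|\gamma\rangle=(-1)^{\gamma^7}|\gamma\rangle$ ($\gamma^7\in\{0,1\}$); up to global phase it equals $X^{\otimes3}\,CCZ\,X^{\otimes3}$. A full-rank matrix $G\in\mathbb F_8^{m\times n}$ with rows $\mathbf g_1,\dots,\mathbf g_m$ and $k$ logical rows defines a CSS code on $n$ qudits: the first $k$ rows are $X$-logical operators, the remaining rows generate the $X$-stabilizer space $\mathcal G_0$; logical basis states are $|\overline u\rangle\propto\sum_{\mathbf g\in\mathcal G_0}|\sum_{a\le k}u_a\mathbf g_a+\mathbf g\rangle$. ''Acts as the logical $N^{\otimes k}$'' means $N^{\otimes n}|\overline u\rangle=(-1)^{\sum_{a\le k}u_a^7}|\overline u\rangle$ for all $u\in\mathbb F_8^k$. The $Z$-distance is the minimum Hamming weight over $\mathbb F_8$ of a vector orthogonal (for $\sum x_iy_i$) to all stabilizer rows but not to at least one logical row. (All seven monomials have total degree $\equiv1\bmod7$, so changing a representative rescales a column by an element of $\mathbb F_8^\times$.) *)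

(* Defs.v *)
From HB Require Import structures.
From mathcomp Require Import all_boot all_order all_algebra.

Set Implicit Arguments.
Unset Strict Implicit.
Unset Printing Implicit Defensive.

Import Order.TTheory GRing.Theory Num.Theory.
Local Open Scope ring_scope.

(* Quantum systems with computational basis |x>, x in T.  The scalars C stand
   for the complex numbers; a register of n systems has basis 'rV[T]_n. *)
Section Quantum.
Variable C : numClosedFieldType.

Definition state (T : finType) := {ffun T -> C^o}.

Definition ket (T : finType) (x : T) : state T := [ffun y => (y == x)%:R].

(* A gate is given by its matrix entries: U y x = <y|U|x>. *)
Definition gate (T : finType) := T -> T -> C.

Definition apply (T : finType) (U : gate T) (psi : state T) : state T :=
  [ffun y => \sum_x U y x * (psi x : C)].

Definition diag_gate (T : finType) (f : T -> C) : gate T :=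
  fun y x => f x *+ (y == x).

Definition tensor_pow (T : finType) (U : gate T) (n : nat) : gate 'rV[T]_n :=
  fun y x => \prod_i U (y 0 i) (x 0 i).

Definition X_gate : gate bool := fun y x => (y == ~~ x)%:R.

Definition CCZ_gate : gate 'rV[bool]_3 :=
  diag_gate (fun x : 'rV[bool]_3 => (-1) ^+ [&& x 0 0, x 0 1 & x 0 2]).

End Quantum.
Arguments tensor_pow {C T} U n y x : rename.

(* The exponent gamma^7 as a natural number; this is the norm of gamma from F
   to F_2 when #|F| = 8, and gamma^7 is then 0 or 1. *)
Definition norm_bit (F : finFieldType) (gamma : F) : nat := (gamma ^+ 7 == 1).

Definition norm_gate (C : numClosedFieldType) (F : finFieldType) : gate C F :=
  diag_gate (fun gamma => (-1) ^+ norm_bit gamma).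
Arguments norm_gate C F : clear implicits.

Section QubitIdentification.
Variables (F : finFieldType) (b : 'I_3 -> F).

Definition F2_comb (s : 'rV[bool]_3) : F := \sum_i b i *+ s 0 i.

(* b is a basis of F over its prime subfield F_2 (F has characteristic 2). *)
Definition F2_basis : Prop :=
  (forall s, F2_comb s = 0 -> forall i, s 0 i = false) /\
  (forall gamma, exists s, F2_comb s = gamma).

(* The identification |F2_comb s> <-> |s> of the qudit with three qubits. *)
Definition as_qubits (C : numClosedFieldType) (psi : state C F) :
    state C 'rV[bool]_3 :=
  [ffun s => psi (F2_comb s)].

End QubitIdentification.

(* The CSS code on n qudits given by G, whose first k rows are the X-logical
   operators and whose last l rows generate the X-stabilizers. *)
Section CSSCode.
Variables (F : finFieldType) (k l n : nat) (G : 'M[F]_(k + l, n)).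

Definition stab_space : {set 'rV[F]_n} := [set g | (g <= dsubmx G)%MS].

Definition logical_state (C : numClosedFieldType) (u : 'rV[F]_k) :
    state C 'rV[F]_n :=
  (sqrtC (#|stab_space|%:R : C))^-1 *:
    \sum_(g in stab_space) ket C (\sum_a u 0 a *: row a (usubmx G) + g).

Definition acts_as_logical_norm (C : numClosedFieldType) : Prop :=
  forall u : 'rV[F]_k,
    apply (tensor_pow (norm_gate C F) n) (logical_state C u) =
    ((-1) ^+ (\sum_a norm_bit (u 0%R a))%N : C) *: logical_state C u.

Definition dot (x y : 'rV[F]_n) : F := \sum_i x 0 i * y 0 i.

Definition hamming_weight (x : 'rV[F]_n) : nat := #|[set i | x 0 i != 0]|.

Definition nontrivial_Z (x : 'rV[F]_n) : Prop :=
  (forall j, dot x (row j (dsubmx G)) = 0) /\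
  (exists a, dot x (row a (usubmx G)) <> 0).

Definition Z_distance_is (d : nat) : Prop :=
  (exists2 x, nontrivial_Z x & hamming_weight x = d) /\
  (forall x, nontrivial_Z x -> (d <= hamming_weight x)%N).

End CSSCode.

Section KleinQuartic.
Variable F : finFieldType.

(* A point of the projective plane is the set of its representatives. *)
Definition proj_point (v : 'rV[F]_3) : {set 'rV[F]_3} :=
  [set c *: v | c in [set c : F | c != 0]].

Definition proj_plane : {set {set 'rV[F]_3}} :=
  [set proj_point v | v in [set v : 'rV[F]_3 | v != 0]].

Definition klein_eq (v : 'rV[F]_3) : bool :=
  let X := v 0 0 in let Y := v 0 1 in let Z := v 0 2 in
  Y ^+ 3 * Z + X ^+ 3 * Y + Z ^+ 3 * X == 0.

Definition klein_quartic : {set {set 'rV[F]_3}} :=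
  [set P in proj_plane | [forall v in P, klein_eq v]].

Definition klein_monomials (v : 'rV[F]_3) : seq F :=
  let X := v 0 0 in let Y := v 0 1 in let Z := v 0 2 in
  [:: X * Y ^+ 2 * Z ^+ 5;
      X ^+ 2 * Y ^+ 5 * Z;
      X ^+ 5 * Y * Z ^+ 2;
      X ^+ 5 * Y ^+ 5 * Z ^+ 5;
      X; Y; Z].

Definition klein_matrix (n : nat) (r : 'I_n -> 'rV[F]_3) : 'M[F]_(4 + 3, n) :=
  \matrix_(a < 4 + 3, i < n) (klein_monomials (r i))`_a.

End KleinQuartic.
Arguments klein_quartic F : clear implicits.

(* Main.v *)
From HB Require Import structures.
Require Import Defs.
From mathcomp Require Import all_boot all_order all_algebra.
From mathcomp Require Import finfield ring.
Import Order.TTheory GRing.Theory Num.Theory.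
Local Open Scope ring_scope.

Set Implicit Arguments.
Unset Strict Implicit.
Unset Printing Implicit Defensive.

(** All seven monomials have degree 1 mod 7, so a product g_a^4 g_b^2 g_c does
    not depend on the representative of a projective point. A point has 7 = 1
    representatives in characteristic 2, hence the sum over the 24 points
    equals the sum over the 168 nonzero vectors of the cone of the curve,
    which is computed in an explicit model of F_8. Writing gamma^7 = gamma^4
    gamma^2 gamma and expanding with Frobenius, the trilinear identity gives
    the parity of the number of nonzero coordinates of a codeword, hence the
    logical gate. It also kills the logical coefficients of a linear relation
    between the rows; evaluating it at the three coordinate points, which lie
    on the curve, kills the others. A vector orthogonal to X, Y, Z is a linear
    relation between representatives, and distinct projective points are
    pairwise independent, so its weight is at least 3; a line through [1:0:0]
    gives weight 3. *)

(** * A computable model of the field with eight elements *)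

(* F_2[t] / (t^3 + t + 1), with (p0, p1, p2) standing for p0 + p1 t + p2 t^2. *)
Definition gf8 : Type := (bool * bool * bool)%type.

HB.instance Definition _ := Finite.copy gf8 (bool * bool * bool)%type.

Definition gf8_add (p q : gf8) : gf8 :=
  let: (p0, p1, p2) := p in let: (q0, q1, q2) := q in
  (p0 (+) q0, p1 (+) q1, p2 (+) q2).

Definition gf8_mul (p q : gf8) : gf8 :=
  let: (p0, p1, p2) := p in let: (q0, q1, q2) := q in
  let r3 := (p1 && q2) (+) (p2 && q1) in
  let r4 := p2 && q2 in
  ((p0 && q0) (+) r3,
   (p0 && q1) (+) (p1 && q0) (+) r3 (+) r4,
   (p0 && q2) (+) (p1 && q1) (+) (p2 && q0) (+) r4).

Fact gf8_addA : associative gf8_add.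
Proof. by move=> [[[] []] []] [[[] []] []] [[[] []] []]. Qed.
Fact gf8_addC : commutative gf8_add.
Proof. by move=> [[[] []] []] [[[] []] []]. Qed.
Fact gf8_add0 : left_id ((false, false, false) : gf8) gf8_add.
Proof. by move=> [[[] []] []]. Qed.
Fact gf8_addN : left_inverse ((false, false, false) : gf8) id gf8_add.
Proof. by move=> [[[] []] []]. Qed.
HB.instance Definition _ :=
  GRing.isZmodule.Build gf8 gf8_addA gf8_addC gf8_add0 gf8_addN.

Fact gf8_mulA : associative gf8_mul.
Proof. by move=> [[[] []] []] [[[] []] []] [[[] []] []]. Qed.
Fact gf8_mulC : commutative gf8_mul.
Proof. by move=> [[[] []] []] [[[] []] []]. Qed.
Fact gf8_mul1 : left_id ((true, false, false) : gf8) gf8_mul.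
Proof. by move=> [[[] []] []]. Qed.
Fact gf8_mulD : left_distributive gf8_mul gf8_add.
Proof. by move=> [[[] []] []] [[[] []] []] [[[] []] []]. Qed.
HB.instance Definition _ :=
  GRing.Zmodule_isComNzRing.Build gf8 gf8_mulA gf8_mulC gf8_mul1 gf8_mulD isT.

(** * Identification of any field of order eight with the model *)

Lemma oppr1_card8 (F : finFieldType) : #|F| = 8%N -> -1 = 1 :> F.
Proof. by move=> cF; rewrite -[LHS]expf_card cF -signr_odd. Qed.

Lemma pchar_card8 (F : finFieldType) : #|F| = 8%N -> 2%N \in [pchar F].
Proof.
move=> cF; rewrite inE /= -[2%N]/(1 + 1)%N natrD -{1}(oppr1_card8 cF).
by rewrite addNr.
Qed.

(** Over F_2, t^8 - t = t (t + 1) (t^3 + t + 1) (t^3 + t^2 + 1), so an element other than 0 and 1 is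
    a root of one of the two cubics, and t -> t + 1 exchanges these cubics. *)
Lemma gf8_root (F : finFieldType) :
  #|F| = 8%N -> exists alpha : F, alpha ^+ 3 = alpha + 1.
Proof.
move=> cF; have ch2 := pchar_card8 cF; have two0 : 2%:R = 0 :> F := pcharf0 ch2.
have [g] : exists g : F, g \notin [:: 0; 1].
  apply/existsP; rewrite -negb_forall; apply/negP => /forallP allg.
  suff : (#|F| <= 2)%N by rewrite cF.
  apply: leq_trans (card_size [:: 0; 1 : F]); apply/subset_leq_card/subsetP.
  by move=> x _; apply: allg.
rewrite !inE negb_or => /andP[g0 g1].
have g8 : g ^+ 8 = g by rewrite -cF expf_card.
have : g * (g + 1) * ((g ^+ 3 + g + 1) * (g ^+ 3 + g ^+ 2 + 1)) = 0.
  (* The factor [2%:R] collects all even coefficients of the expansion over the integers, so that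
     [ring] applies before the characteristic is used. *)
  transitivity (g ^+ 8 + g + 2%:R * (g ^+ 7 + g ^+ 6 + g ^+ 5 *+ 2 +
    g ^+ 4 *+ 2 + g ^+ 3 + g ^+ 2)); first by ring.
  by rewrite two0 g8 (addrr_pchar2 ch2) mul0r addr0.
move/eqP; rewrite !mulf_eq0 (negPf g0) addr_eq0 (oppr_pchar2 ch2) (negPf g1) /=.
have swap (x y : F) : x + y = 0 -> x = y.
  by move/eqP; rewrite addr_eq0 (oppr_pchar2 ch2) => /eqP.
case/orP=> /eqP eq0; first by exists g; apply: swap; rewrite addrA.
exists (g + 1); apply: swap.
transitivity (g ^+ 3 + g ^+ 2 + 1 + 2%:R * (g ^+ 2 + g *+ 2 + 1)); first by ring.
by rewrite eq0 two0 mul0r addr0.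
Qed.

(** The map evaluates polynomials in t at a root [alpha] of t^3 = t + 1. It is injective because
    nonzero elements of the model are invertible, hence bijective by cardinality. *)
Lemma gf8_iso (F : finFieldType) :
  #|F| = 8%N -> exists phi : {rmorphism gf8 -> F}, bijective phi.
Proof.
move=> cF; have ch2 := pchar_card8 cF; have two0 : 2%:R = 0 :> F := pcharf0 ch2.
have [alpha alpha3] := gf8_root cF.
pose f (p : gf8) : F :=
  let: (p0, p1, p2) := p in p0%:R + p1%:R * alpha + p2%:R * alpha ^+ 2.
have bD (b c : bool) : (b (+) c)%:R = b%:R + c%:R :> F.
  by case: b c => [] []; rewrite ?addr0 ?add0r ?(addrr_pchar2 ch2).
have bM (b c : bool) : (b && c)%:R = b%:R * c%:R :> F.
  by case: b c => [] []; rewrite ?mulr1 ?mulr0.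
have fD : {morph f : x y / x + y}.
  by move=> [[x0 x1] x2] [[y0 y1] y2]; rewrite /f /= !bD; ring.
have f0 : f 0 = 0 by rewrite /f /=; ring.
have fM : {morph f : x y / x * y}.
  move=> [[x0 x1] x2] [[y0 y1] y2]; rewrite /f /= !(bD, bM).
  have alpha4 : alpha ^+ 4 = alpha ^+ 2 + alpha.
    by rewrite exprS alpha3; ring.
  (* The two sides differ by multiples of the reduction rules for [alpha ^+ 3] and [alpha ^+ 4]. *)
  apply/esym/eqP; rewrite -subr_eq0; apply/eqP.
  transitivity ((x1%:R * y2%:R + x2%:R * y1%:R) * (alpha ^+ 3 - (alpha + 1))
    + x2%:R * y2%:R * (alpha ^+ 4 - (alpha ^+ 2 + alpha))); first by ring.
  by rewrite alpha3 alpha4 !subrr !mulr0 addr0.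
have f1 : f 1 = 1 by rewrite /f /=; ring.
pose fA := GRing.isNmodMorphism.Build gf8 F f (conj f0 fD).
pose fMul := GRing.isMonoidMorphism.Build gf8 F f (conj f1 fM).
pose phi : {rmorphism gf8 -> F} := HB.pack f fA fMul.
exists phi; apply: inj_card_bij; last by rewrite cF !card_prod card_bool.
apply: raddf_inj => x phix0; apply: contraTeq (oner_neq0 F) => x_neq0.
have [y xy1] : exists y, x * y = 1.
  (* The multiplicative group has order 7, so the inverse is the sixth power. *)
  exists (x ^+ 6); case: x x_neq0 {phix0} => [[[] []] []] //.
by rewrite -(rmorph1 phi) -xy1 rmorphM phix0 mul0r eqxx.
Qed.

(** * The affine cone of the quartic, by computation in the model *)

Definition gf8_enum : seq gf8 :=
  [seq (p, p2) | p <- [seq (p0, p1) | p0 <- [:: false; true],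
                                      p1 <- [:: false; true]],
                 p2 <- [:: false; true]].

(** The cone is kept as an explicit list of triples, so that [vm_compute] can enumerate it. *)
Definition gf8_klein : seq (gf8 * gf8 * gf8) :=
  [seq t <- [seq (p, z) | p <- [seq (x, y) | x <- gf8_enum, y <- gf8_enum],
                          z <- gf8_enum]
     | let: (x, y, z) := t in
       (t != (0, 0, 0)) && (y ^+ 3 * z + x ^+ 3 * y + z ^+ 3 * x == 0)].

(** The counterpart of [klein_monomials] on scalars, free of matrices for the sake of
    computation. *)
Definition monomials (R : pzRingType) (x y z : R) : seq R :=
  [:: x * y ^+ 2 * z ^+ 5; x ^+ 2 * y ^+ 5 * z; x ^+ 5 * y * z ^+ 2;
      x ^+ 5 * y ^+ 5 * z ^+ 5; x; y; z].

Lemma size_gf8_klein : size gf8_klein = 168%N.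
Proof. by vm_compute. Qed.

Lemma uniq_gf8_klein : uniq gf8_klein.
Proof. by vm_compute. Qed.

Lemma gf8_klein_mem (x y z : gf8) : ((x, y, z) \in gf8_klein) =
  ((x, y, z) != (0, 0, 0)) && (y ^+ 3 * z + x ^+ 3 * y + z ^+ 3 * x == 0).
Proof.
have en (p : gf8) : p \in gf8_enum by case: p => [[[] []] []].
by rewrite mem_filter !allpairs_f // andbT.
Qed.

Lemma gf8_klein_trilinear (a b c : nat) : (a < 7)%N -> (b < 7)%N -> (c < 7)%N ->
  \sum_(t <- gf8_klein) (let m := monomials t.1.1 t.1.2 t.2 in
                         m`_a ^+ 4 * m`_b ^+ 2 * m`_c)
  = [&& a == b, b == c & (a < 4)%N]%:R.
Proof.
pose ok a b c := \sum_(t <- gf8_klein) (let m := monomials t.1.1 t.1.2 t.2 in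
     m`_a ^+ 4 * m`_b ^+ 2 * m`_c) == [&& a == b, b == c & (a < 4)%N]%:R.
have : all (fun a => all (fun b => all (ok a b) (iota 0 7)) (iota 0 7)) (iota 0 7).
  (* Big sums are locked; [unlock] turns them into folds that reduce. All 343 index triples are then
     checked. *)
  by rewrite /ok unlock; vm_compute.
have mem7 i : (i < 7)%N -> i \in iota 0 7 by rewrite mem_iota.
move=> /allP tri /mem7 la /mem7 lb /mem7 lc.
by have /allP/(_ c lc)/eqP := allP (tri a la) b lb.
Qed.

Definition row3 (R : pzRingType) (x y z : R) : 'rV[R]_3 := \row_j [:: x; y; z]`_j.

Lemma row3E (R : pzRingType) (x y z : R) :
  (row3 x y z 0 0 = x) * (row3 x y z 0 1 = y) * (row3 x y z 0 2 = z).
Proof. by rewrite !mxE. Qed.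

Lemma row3_eta (R : pzRingType) (v : 'rV[R]_3) : v = row3 (v 0 0) (v 0 1) (v 0 2).
Proof.
apply/rowP => j; rewrite mxE.
by case: j => [[|[|[|//]]] ?] /=; congr (v _ _); apply: val_inj.
Qed.

Lemma row3_0 (R : pzRingType) : row3 0 0 0 = 0 :> 'rV[R]_3.
Proof. by rewrite [RHS]row3_eta !mxE. Qed.

(** Summing over the cone, with the origin removed, avoids any choice of representatives. *)
Definition klein_cone (F : finFieldType) : {set 'rV[F]_3} :=
  [set v | (v != 0) && klein_eq v].

Definition map_row3 (F : finFieldType) (phi : gf8 -> F) (t : gf8 * gf8 * gf8) :=
  row3 (phi t.1.1) (phi t.1.2) (phi t.2).

Lemma klein_monomials_map_row3 (F : finFieldType) (phi : {rmorphism gf8 -> F}) t :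
  klein_monomials (map_row3 phi t) = map phi (monomials t.1.1 t.1.2 t.2).
Proof. by rewrite /klein_monomials !row3E /= !(rmorphM, rmorphXn). Qed.

(** The equation has coefficients in F_2, so a field isomorphism matches its solutions; sums over
    the cone become sums over the computed list. *)
Lemma perm_klein_cone (F : finFieldType) (phi : {rmorphism gf8 -> F}) :
  bijective phi ->
  perm_eq (enum (klein_cone F)) [seq map_row3 phi t | t <- gf8_klein].
Proof.
move=> bij_phi; have inj_phi := bij_inj bij_phi; case: bij_phi => psi phiK psiK.
have inj_map : injective (map_row3 phi).
  move=> [[x y] z] [[x' y'] z'] /rowP eq3.
  have := (eq3 0, eq3 1, eq3 2); rewrite /map_row3 !row3E /=.
  by case=> [[/inj_phi-> /inj_phi->] /inj_phi->].
have map_mem x y z : (row3 (phi x) (phi y) (phi z) \in klein_cone F)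
    = ((x, y, z) \in gf8_klein).
  have -> : row3 (phi x) (phi y) (phi z) = map_row3 phi (x, y, z) by [].
  rewrite inE gf8_klein_mem -row3_0 -(rmorph0 phi) (inj_eq inj_map (x, y, z) (0, 0, 0)).
  by rewrite /klein_eq !row3E -!rmorphXn -!rmorphM -!rmorphD -(inj_eq inj_phi) rmorph0.
apply: uniq_perm; first exact: enum_uniq.
  by rewrite map_inj_uniq ?uniq_gf8_klein.
move=> v; rewrite mem_enum; apply/idP/mapP => [v_in | [[[x y] z] t_in ->]].
  exists (psi (v 0 0), psi (v 0 1), psi (v 0 2)).
    by rewrite -map_mem !psiK -row3_eta.
  by rewrite /map_row3 /= !psiK -row3_eta.
by rewrite map_mem.
Qed.

Lemma card_klein_cone (F : finFieldType) : #|F| = 8%N -> #|klein_cone F| = 168%N.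
Proof.
move=> cF; have [phi bij_phi] := gf8_iso cF.
by rewrite cardE (perm_size (perm_klein_cone bij_phi)) size_map size_gf8_klein.
Qed.

Lemma klein_cone_trilinear (F : finFieldType) (a b c : nat) : #|F| = 8%N ->
    (a < 7)%N -> (b < 7)%N -> (c < 7)%N ->
  \sum_(v in klein_cone F) (klein_monomials v)`_a ^+ 4 *
      (klein_monomials v)`_b ^+ 2 * (klein_monomials v)`_c
  = [&& a == b, b == c & (a < 4)%N]%:R.
Proof.
move=> cF la lb lc; have [phi bij_phi] := gf8_iso cF.
rewrite -big_enum /= (perm_big _ (perm_klein_cone bij_phi)) big_map.
rewrite -(rmorph_nat phi) -(gf8_klein_trilinear la lb lc) rmorph_sum.
apply: eq_bigr => t _.
by rewrite klein_monomials_map_row3 !(nth_map 0) // !rmorphM.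
Qed.

(** * Projective points and the count of the curve *)

Lemma mem_proj_point (F : finFieldType) (v : 'rV[F]_3) : v \in proj_point v.
Proof. by apply/imsetP; exists 1; rewrite ?inE ?oner_eq0 ?scale1r. Qed.

Lemma proj_pointZ (F : finFieldType) (c : F) (v : 'rV[F]_3) :
  c != 0 -> proj_point (c *: v) = proj_point v.
Proof.
move=> c0; apply/setP => w; apply/imsetP/imsetP => -[d]; rewrite inE => d0 ->.
  by exists (d * c); rewrite ?inE ?mulf_neq0 ?scalerA.
by exists (d / c); rewrite ?inE ?mulf_neq0 ?invr_eq0 // scalerA divfK.
Qed.

Lemma proj_point_eq (F : finFieldType) (v w : 'rV[F]_3) :
  w \in proj_point v -> proj_point w = proj_point v.
Proof. by case/imsetP => c /[!inE] c0 ->; apply: proj_pointZ. Qed.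

Lemma card_proj_point (F : finFieldType) (v : 'rV[F]_3) :
  v != 0 -> #|proj_point v| = #|F|.-1.
Proof.
move=> v0; rewrite card_imset => [|c d /eqP]; last first.
  by rewrite -subr_eq0 -scalerBl scaler_eq0 (negPf v0) orbF subr_eq0 => /eqP.
by rewrite -(cardsC1 (0 : F)); apply: eq_card => c; rewrite !inE.
Qed.

(** The equation is homogeneous of degree 4, so scaling multiplies it by c^4. *)
Lemma klein_eqZ (F : finFieldType) (c : F) (v : 'rV[F]_3) :
  c != 0 -> klein_eq (c *: v) = klein_eq v.
Proof.
move=> c0; rewrite /klein_eq !mxE.
rewrite -[RHS](inj_eq (mulfI (expf_neq0 4 c0))) mulr0; congr (_ == 0); ring.
Qed.

Lemma klein_quarticE (F : finFieldType) :
  klein_quartic F = [set proj_point v | v in klein_cone F].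
Proof.
apply/setP => A; rewrite inE; apply/andP/imsetP => [[/imsetP[v] v0 ->]|[v]].
  move=> /forallP/(_ v); rewrite mem_proj_point /= => kv.
  by exists v => //; move: v0; rewrite !inE => ->.
rewrite inE => /andP[v0 kv] ->; split; first by apply/imsetP; exists v; rewrite ?inE.
apply/forall_inP => w /imsetP[c] /[!inE] c0 ->; by rewrite klein_eqZ.
Qed.

Lemma partition_klein_quartic (F : finFieldType) :
  partition (klein_quartic F) (klein_cone F).
Proof.
rewrite klein_quarticE; apply/and3P; split.
- apply/eqP/setP => w; apply/bigcupP/idP => [[_ /imsetP[v v_in ->]]|w_in].
    case/imsetP => c /[!inE] c0 ->; move: v_in.
    by rewrite inE klein_eqZ // scaler_eq0 (negPf c0).
  by exists (proj_point w); rewrite ?imset_f ?mem_proj_point.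
- apply/trivIsetP => _ _ /imsetP[v _ ->] /imsetP[w _ ->].
  apply: contraR => /pred0Pn[x /andP[/= xv xw]].
  by rewrite -(proj_point_eq xv) (proj_point_eq xw).
- by apply/imsetP => -[v _ eq0]; have := mem_proj_point v; rewrite -eq0 inE.
Qed.

(** The 168 vectors of the cone split into points of 7 representatives each. *)
Lemma card_klein_quartic (F : finFieldType) :
  #|F| = 8%N -> #|klein_quartic F| = 24%N.
Proof.
move=> cF; have := card_klein_cone cF.
rewrite (card_uniform_partition (n := 7) _ (partition_klein_quartic F)) => [|A].
  by move/eqP; rewrite -[168%N]/(24 * 7)%N eqn_pmul2r // => /eqP.
rewrite klein_quarticE => /imsetP[v] /[!inE] /andP[v0 _] ->.
by rewrite card_proj_point // cF.
Qed.

(** * Diagonal gates, and the norm gate as a conjugate of CCZ *)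

Lemma expf7_card8 (F : finFieldType) (x : F) :
  #|F| = 8%N -> x ^+ 7 = (x != 0)%:R.
Proof.
move=> cF; have [->|x0] := eqVneq x 0; first by rewrite expr0n.
by apply: (mulfI x0); rewrite -exprS mulr1 -cF expf_card.
Qed.

Lemma norm_bitE (F : finFieldType) (x : F) :
  #|F| = 8%N -> norm_bit x = (x != 0).
Proof.
move=> cF; rewrite /norm_bit expf7_card8 //.
by case: (x != 0); rewrite ?eqxx // eq_sym oner_eq0.
Qed.

Lemma apply_diag (C : numClosedFieldType) (T : finType) (f : T -> C)
    (psi : state C T) y : apply (diag_gate f) psi y = f y * psi y.
Proof.
rewrite ffunE (bigD1 y) //= /diag_gate eqxx big1 ?addr0 // => x.
by rewrite eq_sym => /negPf->; rewrite mul0r.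
Qed.

Lemma tensor_pow_diag (C : numClosedFieldType) (T : finType) (f : T -> C) n y x :
  tensor_pow (diag_gate f) n y x =
    diag_gate (fun x : 'rV[T]_n => \prod_i f (x 0 i)) y x.
Proof.
rewrite /tensor_pow /diag_gate; have [->|] := eqVneq y x.
  by rewrite mulr1n; apply: eq_bigr => i _; rewrite eqxx.
move=> neq_yx; have /existsP[i yx_i] : [exists i, y 0 i != x 0 i].
  rewrite -negb_forall; apply: contra neq_yx => /forallP eq_yx.
  by apply/eqP/rowP => i; apply/eqP.
by rewrite (bigD1 i) //= (negPf yx_i) mul0r.
Qed.

Lemma apply_tensor_diag (C : numClosedFieldType) (T : finType) (f : T -> C) n
    (psi : state C 'rV[T]_n) y :
  apply (tensor_pow (diag_gate f) n) psi y = (\prod_i f (y 0 i)) * psi y.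
Proof.
rewrite -(apply_diag (fun y : 'rV[T]_n => \prod_i f (y 0 i))) !ffunE.
by apply: eq_bigr => x _; rewrite tensor_pow_diag.
Qed.

Lemma apply_tensor_X (C : numClosedFieldType) n (psi : state C 'rV[bool]_n) y :
  apply (tensor_pow (X_gate C) n) psi y = psi (map_mx negb y).
Proof.
rewrite ffunE (bigD1 (map_mx negb y)) //= big1 ?addr0 => [|x neq_xy].
  by rewrite /tensor_pow big1 ?mul1r // => i _; rewrite /X_gate !mxE negbK eqxx.
have /existsP[i xy_i] : [exists i, x 0 i != ~~ y 0 i].
  rewrite -negb_forall; apply: contra neq_xy => /forallP eq_xy.
  by apply/eqP/rowP => i; rewrite mxE; apply/eqP.
rewrite /tensor_pow (bigD1 i) //= /X_gate.
by case: (x 0 i) xy_i => [] /=; case: (y 0 i); rewrite ?mul0r.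
Qed.

(** The norm gate flips the sign of every basis state except that of 0, while CCZ conjugated by X
    flips only that of 0; the two differ by the global phase -1. *)
Lemma norm_gate_CCZ (F : finFieldType) (C : numClosedFieldType) (b : 'I_3 -> F)
    (psi : state C F) : #|F| = 8%N -> F2_basis b ->
  as_qubits b (apply (norm_gate C F) psi) =
  -1 *: apply (tensor_pow (X_gate C) 3)
          (apply (CCZ_gate C) (apply (tensor_pow (X_gate C) 3) (as_qubits b psi))).
Proof.
move=> cF [b_free _]; apply/ffunP => s.
rewrite [in LHS]ffunE apply_diag [in RHS]ffunE apply_tensor_X apply_diag apply_tensor_X.
have -> : map_mx negb (map_mx negb s) = s by apply/rowP => i; rewrite !mxE negbK.
rewrite [as_qubits b psi s]ffunE norm_bitE // !mxE.
(* Linear independence: the field element is nonzero exactly when some bit is set. *)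
have -> : F2_comb b s != 0 = [|| s 0 0, s 0 1 | s 0 2].
  apply/idP/idP; last by apply: contraL => /eqP/b_free s0; rewrite !s0.
  apply: contraNT; rewrite !negb_or => /and3P[s0 s1 s2].
  apply/eqP; rewrite /F2_comb !big_ord_recl big_ord0.
  have -> : lift ord0 ord0 = 1 :> 'I_3 by apply: val_inj.
  have -> : lift ord0 (lift ord0 ord0) = 2 :> 'I_3 by apply: val_inj.
  by rewrite (negPf s0) (negPf s1) (negPf s2) !mulr0n !addr0.
rewrite /GRing.scale /= mulrA; congr (_ * _).
by case: (s 0 0); case: (s 0 1); case: (s 0 2);
  rewrite /= ?expr0 ?expr1 ?mulr1 ?mulN1r ?opprK.
Qed.

(** * From the trilinear identity to the logical gate *)

(** In characteristic 2 the image of a natural number in F records its parity, which is all that an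
    exponent of -1 needs. *)
Lemma natr_card8 (F : finFieldType) (n : nat) : #|F| = 8%N -> n%:R = (odd n)%:R :> F.
Proof.
move=> cF; rewrite -[in LHS](odd_double_half n) natrD -mul2n natrM.
by rewrite (pcharf0 (pchar_card8 cF)) mul0r addr0.
Qed.

Lemma big_sqr (F : finFieldType) (I : finType) (f : I -> F) : #|F| = 8%N ->
  (\sum_i f i) ^+ 2 = \sum_i f i ^+ 2.
Proof.
move=> cF; have ch2 := pchar_card8 cF.
by rewrite -[LHS](pFrobenius_autE ch2) rmorph_sum; apply: eq_bigr.
Qed.

Definition trilinear (F : finFieldType) k l n (G : 'M[F]_(k + l, n)) :=
  forall a b c, \sum_i G a i ^+ 4 * G b i ^+ 2 * G c i =
    (if [&& a == b, b == c & (a < k)%N] then 1 else 0).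

(** Since 7 = 4 + 2 + 1 and squaring is additive, the seventh power of a codeword entry expands into
    a sum over triples of rows. Summed over the columns, only triples a = b = c of logical rows
    survive. *)
Lemma trilinear_sum7 (F : finFieldType) k l n (G : 'M[F]_(k + l, n))
    (u : 'rV[F]_k) (w : 'rV[F]_l) : #|F| = 8%N -> trilinear G ->
  \sum_i (row_mx u w *m G) 0 i ^+ 7 = \sum_a u 0 a ^+ 7.
Proof.
move=> cF tri; set v := row_mx u w.
transitivity (\sum_i \sum_a \sum_b \sum_c
    v 0 a ^+ 4 * v 0 b ^+ 2 * v 0 c * (G a i ^+ 4 * G b i ^+ 2 * G c i)).
  apply: eq_bigr => i _; rewrite mxE.
  set s := (X in X ^+ 7); have -> : s ^+ 7 = (s ^+ 2) ^+ 2 * s ^+ 2 * s by ring.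
  rewrite {1 2 3}/s !big_sqr // -mulrA mulr_suml; apply: eq_bigr => a _ /=.
  rewrite mulr_suml mulr_sumr; apply: eq_bigr => b _ /=.
  by rewrite mulrA mulr_sumr; apply: eq_bigr => c _; rewrite /=; ring.
transitivity (\sum_(a < k + l) \sum_(b < k + l) \sum_(c < k + l)
    v 0 a ^+ 4 * v 0 b ^+ 2 * v 0 c *
    (if [&& a == b, b == c & (a < k)%N] then 1 else 0)).
  rewrite exchange_big; apply: eq_bigr => a _ /=.
  rewrite exchange_big; apply: eq_bigr => b _ /=.
  rewrite exchange_big; apply: eq_bigr => c _ /=.
  by rewrite -mulr_sumr tri.
transitivity (\sum_(a < k + l) (if (a < k)%N then v 0 a ^+ 7 else 0)).
  apply: eq_bigr => a _.
  rewrite (bigD1 a) //= [X in _ + X]big1 ?addr0 => [|b /negPf ab]; last first.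
    by rewrite big1 // => c _; rewrite eq_sym ab mulr0.
  rewrite (bigD1 a) //= big1 ?addr0 => [|c /negPf ac]; last first.
    by rewrite eqxx eq_sym ac mulr0.
  by rewrite !eqxx /=; case: ifP => _; [ring | rewrite mulr0].
rewrite big_split_ord /= [X in _ + X]big1 ?addr0 => [|a _]; last first.
  by rewrite ltnNge leq_addr.
by apply: eq_bigr => a _; rewrite ltn_ord row_mxEl.
Qed.

(** Every basis vector in the support of a logical state is a codeword, and the parity of its norm
    bits depends on [u] alone, so all of them receive the same sign. *)
Lemma trilinear_norm (F : finFieldType) (C : numClosedFieldType) k l n
    (G : 'M[F]_(k + l, n)) : #|F| = 8%N -> trilinear G -> acts_as_logical_norm G C.
Proof.
move=> cF tri u; apply/ffunP => y.
rewrite apply_tensor_diag /logical_state !ffunE /GRing.scale /= mulrCA [RHS]mulrCA.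
congr (_ * _); rewrite !sum_ffunE !mulr_sumr; apply: eq_bigr => g g_stab.
rewrite !ffunE; have [y_def|] := eqVneq; last by rewrite !mulr0.
congr (_ * _); rewrite -expr_sum /=.
rewrite -[LHS]signr_odd -[RHS]signr_odd; congr (_ ^+ nat_of_bool _).
(* The two parities are compared as elements of F, where norm bits become seventh powers. *)
have inj2 (b c : bool) : b%:R = c%:R :> F -> b = c.
  by case: b c => [] [] // /eqP; rewrite ?oner_eq0 // eq_sym oner_eq0.
apply: inj2; rewrite -!natr_card8 // !natr_sum.
have bit (x : F) : (norm_bit x)%:R = x ^+ 7 by rewrite norm_bitE // expf7_card8.
under eq_bigr do rewrite bit; under [RHS]eq_bigr do rewrite bit.
move: g_stab; rewrite inE => /submxP[w g_def].
have -> : y = row_mx u w *m G.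
  by rewrite y_def g_def -[in RHS](vsubmxK G) mul_row_col (mulmx_sum_row u).
exact: trilinear_sum7.
Qed.

(** * Columns indexed by representatives of the points *)

(** The degrees are 8, 15 and 1, and c^8 = c^15 = c. Past the seventh entry both sides are the
    default 0. *)
Lemma nth_klein_monomialsZ (F : finFieldType) (c : F) (v : 'rV[F]_3) (a : nat) :
  #|F| = 8%N -> (klein_monomials (c *: v))`_a = c * (klein_monomials v)`_a.
Proof.
move=> cF; have c8 : c ^+ 8 = c by rewrite -cF expf_card.
have c15 : c ^+ 15 = c by rewrite -[15%N]/(8 + 7)%N exprD c8 -exprS.
case: a => [|[|[|[|[|[|[|a]]]]]]] /=; rewrite ?nth_nil ?mulr0 // !mxE //.
- rewrite -[in RHS]c8; ring.
- rewrite -[in RHS]c8; ring.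
- rewrite -[in RHS]c8; ring.
- rewrite -[in RHS]c15; ring.
Qed.

Definition klein_representatives (F : finFieldType) (r : 'I_24 -> 'rV[F]_3) :=
  exists P : 'I_24 -> {set 'rV[F]_3},
    [/\ injective P, [set P i | i : 'I_24] = klein_quartic F
        & forall i, r i \in P i].

Lemma klein_representativesP (F : finFieldType) r P :
  [set P i | i : 'I_24] = klein_quartic F ->
  (forall i, r i \in P i) -> forall i, P i = proj_point (r i) /\ r i \in klein_cone F.
Proof.
move=> imP rP i; have : P i \in klein_quartic F by rewrite -imP imset_f.
have := cover_partition (partition_klein_quartic F).
rewrite klein_quarticE => cover_cone Pi_in; split.
  by case/imsetP: Pi_in (rP i) => v _ -> /proj_point_eq->.
by rewrite -cover_cone; apply/bigcupP; exists (P i).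
Qed.

(** The summand is constant on each point, and 7 equal terms add up to one in characteristic 2, so
    the sum over representatives is the sum over the whole cone. *)
Lemma klein_representatives_trilinear (F : finFieldType) r : #|F| = 8%N ->
  klein_representatives r -> trilinear (klein_matrix r : 'M[F]_(4 + 3, 24)).
Proof.
move=> cF [P [inj_P imP rP]] a b c.
pose f v := (klein_monomials v)`_a ^+ 4 * (klein_monomials v)`_b ^+ 2 *
  (klein_monomials v)`_c : F.
transitivity (\sum_(v in klein_cone F) f v); last first.
  by rewrite klein_cone_trilinear // -!val_eqE; case: ifP.
rewrite -(cover_partition (partition_klein_quartic F)).
rewrite big_trivIset; last by have /and3P[] := partition_klein_quartic F.
rewrite -imP big_imset /=; last by move=> ? ? _ _ /inj_P.
apply: eq_bigr => i _; rewrite !mxE -/(f (r i)).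
have [-> /[!inE] /andP[ri0 _]] := klein_representativesP imP rP i.
transitivity (\sum_(v in proj_point (r i)) f (r i)).
  rewrite sumr_const card_proj_point // cF -[_.-1]/(2 * 3 + 1)%N mulrnDr mulrnA.
  by rewrite mulr2n (addrr_pchar2 (pchar_card8 cF)) mul0rn add0r.
apply: eq_bigr => _ /imsetP[t /[!inE] t0 ->].
rewrite /f !nth_klein_monomialsZ // !exprMn.
set A := _`_a; set B := _`_b; set D := _`_c.
(* Scaling by [t] contributes t^(4+2+1) = t^7 = 1. *)
transitivity (t ^+ 7 * (A ^+ 4 * B ^+ 2 * D)); last by ring.
by rewrite expf7_card8 // t0 mul1r.
Qed.

(** Gives access to the column at a chosen point of the curve, up to a nonzero scalar. *)
Lemma klein_representative_of (F : finFieldType) r (v : 'rV[F]_3) :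
  klein_representatives r ->
  v \in klein_cone F -> exists i (c : F), c != 0 /\ r i = c *: v.
Proof.
move=> [P [inj_P imP rP]] v_in.
have : proj_point v \in klein_quartic F by rewrite klein_quarticE imset_f.
rewrite -imP => /imsetP[i _ Pi]; exists i.
by have := rP i; rewrite -Pi => /imsetP[c /[!inE] c0 ->]; exists c.
Qed.

Lemma klein_representatives_inj (F : finFieldType) r i j (c : F) :
  klein_representatives r ->
  c != 0 -> r i = c *: r j -> i = j.
Proof.
move=> [P [inj_P imP rP]] c0 eq_r; apply: inj_P.
have [-> _] := klein_representativesP imP rP i.
have [-> _] := klein_representativesP imP rP j.
by rewrite eq_r proj_pointZ.
Qed.

Lemma klein_representatives_neq0 (F : finFieldType) (r : _ -> 'rV[F]_3) i :
  klein_representatives r -> r i != 0.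
Proof.
move=> [P [inj_P imP rP]].
by have [_ /[!inE] /andP[]] := klein_representativesP imP rP i.
Qed.

(** * Full rank *)

Lemma klein_matrix_row_free (F : finFieldType) r : #|F| = 8%N ->
  klein_representatives r -> row_free (klein_matrix r : 'M[F]_(4 + 3, 24)).
Proof.
move=> cF rP; have tri := klein_representatives_trilinear cF rP.
rewrite -kermx_eq0; apply/rowV0P => u /sub_kermxP uG.
have uG_i i : \sum_a u 0 a * klein_matrix r a i = 0.
  by have /rowP/(_ i) := uG; rewrite !mxE.
have u_logical (a : 'I_(4 + 3)) : (a < 4)%N -> u 0 a = 0.
  (* Pairing the relation with the sixth powers of row [a] isolates the coefficient [u 0 a], by the
     trilinear identity with its first two indices equal to [a]. *)
  move=> a4; transitivity (\sum_i klein_matrix r a i ^+ 4 * klein_matrix r a i ^+ 2 *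
      (\sum_c u 0 c * klein_matrix r c i)).
    under eq_bigr do rewrite mulr_sumr.
    rewrite exchange_big (bigD1 a) //= [X in _ + X]big1 ?addr0 => [|c /negPf ac].
      under eq_bigr do rewrite mulrCA.
      by rewrite -mulr_sumr tri !eqxx a4 mulr1.
    under eq_bigr do rewrite mulrCA.
    by rewrite -mulr_sumr tri eqxx eq_sym ac mulr0.
  by apply: big1 => i _; rewrite uG_i mulr0.
have u_stab (k : 'I_3) : u 0 (rshift 4 k) = 0.
  (* The coordinate points lie on the curve. At the corresponding column only one stabilizer row is
     nonzero, and the logical coefficients are already known to vanish. *)
  have v_in : delta_mx 0 k \in klein_cone F.
    rewrite inE; apply/andP; split.
      by apply/eqP => /rowP/(_ k)/eqP; rewrite !mxE !eqxx oner_eq0.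
    rewrite /klein_eq !mxE /=.
    by case: k => [[|[|[|//]]] ?]; rewrite /= !(mul0r, mulr0, expr0n, addr0).
  have [i [c [c0 ri]]] := klein_representative_of rP v_in.
  have := uG_i i; rewrite (bigD1 (rshift 4 k)) //= big1 => [|a ak].
    rewrite addr0 mxE ri => /eqP; rewrite mulf_eq0 => /orP[/eqP //|].
    rewrite nth_klein_monomialsZ // mulf_eq0 (negPf c0) /= !mxE.
    by case: k {v_in ri} => [[|[|[|//]]] ?]; rewrite /= oner_eq0.
  case: (ltnP a 4) => a4; first by rewrite u_logical ?mul0r.
  rewrite mxE ri nth_klein_monomialsZ //.
  suff -> : (klein_monomials (delta_mx 0 k : 'rV[F]_3))`_a = 0 by rewrite !mulr0.
  move: a4 ak; rewrite -val_eqE /= /klein_monomials !mxE.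
  by case: a => [[|[|[|[|[|[|[|//]]]]]]] ?]; case: k {v_in ri} => [[|[|[|//]]] ?].
apply/rowP => a; rewrite [RHS]mxE; case: (splitP a) => k ak.
  by apply: u_logical; rewrite ak.
by rewrite (_ : a = rshift 4 k) //; apply: val_inj.
Qed.

(** * The Z-distance *)

(** The stabilizer rows X, Y, Z list the coordinates of the representatives, so orthogonality to
    them is a linear relation among these vectors. *)
Lemma klein_Z_orthogonal (F : finFieldType) r (x : 'rV[F]_24) :
  (forall j, dot x (row j (dsubmx (klein_matrix r : 'M[F]_(4 + 3, 24)))) = 0) <->
  \sum_i x 0 i *: r i = 0.
Proof.
have eq_dot (j : 'I_3) : dot x (row j (dsubmx (klein_matrix r : 'M[F]_(4 + 3, 24))))
    = (\sum_i x 0 i *: r i) 0 j.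
  rewrite /dot summxE; apply: eq_bigr => i _; rewrite !mxE; congr (_ * _).
  by case: j => [[|[|[|//]]] ?] /=; congr (r i _ _); apply: val_inj.
split=> [orth|sum0 j]; last by rewrite eq_dot sum0 mxE.
by apply/rowP => j; rewrite -eq_dot orth mxE.
Qed.

Lemma klein_Z_weight (F : finFieldType) r (x : 'rV[F]_24) :
  klein_representatives r ->
  nontrivial_Z (klein_matrix r : 'M[F]_(4 + 3, 24)) x ->
  (3 <= hamming_weight x)%N.
Proof.
move=> rP [/klein_Z_orthogonal sum0 [a dot_a]].
have x0 i : i \notin [set i | x 0 i != 0] -> x 0 i = 0.
  by rewrite inE negbK => /eqP.
(* Weight 2 would make two distinct points proportional, weight 1 would make a representative zero,
   and weight 0 would make every dot product zero. *)
rewrite leqNgt ltnS leq_eqVlt ltnS leq_eqVlt ltnS leqn0; apply/negP.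
case/or3P => [/cards2P[i [j [ij supp]]]|/cards1P[i supp]|].
- have xi : x 0 i != 0 by have := set21 i j; rewrite -supp inE.
  have xj : x 0 j != 0 by have := set22 i j; rewrite -supp inE.
  move: sum0; rewrite (bigD1 i) //= (bigD1 j) 1?eq_sym //= big1;
    last move=> k /andP[ki kj]; last first.
    by rewrite x0 ?scale0r // supp !inE negb_or ki kj.
  rewrite addr0 => /eqP; rewrite addr_eq0 => /eqP eq_ij.
  case/eqP: ij; apply: (klein_representatives_inj rP (c := - ((x 0 i)^-1 * x 0 j))).
    by rewrite oppr_eq0 mulf_neq0 ?invr_eq0.
  by rewrite scaleNr -scalerA -scalerN -eq_ij scalerA mulVf ?scale1r.
- have xi : x 0 i != 0 by have := set11 i; rewrite -supp inE.
  move: sum0; rewrite (bigD1 i) //= big1 => [|k ki].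
    move/eqP; rewrite addr0 scaler_eq0 (negPf xi).
    by rewrite (negPf (klein_representatives_neq0 i rP)).
  by rewrite x0 ?scale0r // supp inE.
- rewrite cards_eq0 => /eqP supp; case: dot_a; rewrite /dot big1 // => i _.
  by rewrite x0 ?mul0r // supp inE.
Qed.

Lemma klein_Z_weight3 (F : finFieldType) r :
  #|F| = 8%N -> klein_representatives r ->
  exists2 x, nontrivial_Z (klein_matrix r : 'M[F]_(4 + 3, 24)) x
           & hamming_weight x = 3%N.
Proof.
move=> cF rP; have ch2 := pchar_card8 cF.
have [alpha alpha3] := gf8_root cF.
have neq01 : 0 != 1 :> F by rewrite eq_sym oner_neq0.
have alpha0 : alpha != 0.
  by apply/eqP => a0; move/eqP: alpha3; rewrite a0 expr0n add0r (negPf neq01).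
have alpha1 : alpha + 1 != 0.
  by apply: contraNneq alpha0 => a1; move: alpha3; rewrite a1 => /eqP; rewrite expf_eq0.
(* Chosen so that (alpha, 1, 1) + (alpha^2, 1, 1) = beta (1, 0, 0): the three points are collinear
   on Y = Z. *)
pose beta := alpha + alpha ^+ 2.
have beta0 : beta != 0.
  have -> : beta = alpha * (alpha + 1) by rewrite /beta; ring.
  by rewrite mulf_neq0.
pose p := row3 1 0 0 : 'rV[F]_3.
pose q t := row3 t 1 1 : 'rV[F]_3.
have pq0 c t : p <> c *: q t.
  move/rowP => eq_pq; have := eq_pq 1; rewrite !mxE /= mulr1 => c0.
  by have /eqP := eq_pq 0; rewrite !mxE /= -c0 mul0r oner_eq0.
have p_in : p \in klein_cone F.
  rewrite inE /klein_eq !row3E /= !(mul0r, mulr0, expr0n, addr0) eqxx andbT.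
  by apply/eqP => p0; apply: (pq0 0 0); rewrite scale0r.
(* At Y = Z = 1 the quartic becomes t^3 + t + 1 = 0, whose roots include [alpha] and its Frobenius
   image [alpha ^+ 2]. *)
have q_in t : t ^+ 3 = t + 1 -> q t \in klein_cone F.
  move=> t3; rewrite inE; apply/andP; split.
    by apply/eqP => /rowP/(_ 1)/eqP; rewrite !mxE oner_eq0.
  rewrite /klein_eq !row3E t3; apply/eqP.
  transitivity (2%:R * (t + 1)); first by ring.
  by rewrite (pcharf0 ch2) mul0r.
have q_eq c d t u : d != 0 -> d *: q t = c *: q u -> t = u.
  move=> d0 /rowP eq_q; have := eq_q 1; rewrite !mxE /= !mulr1 => eq_dc.
  by have := eq_q 0; rewrite !mxE /= -eq_dc => /(mulfI d0).
have alpha2_3 : (alpha ^+ 2) ^+ 3 = alpha ^+ 2 + 1.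
  rewrite exprAC alpha3 sqrrD expr1n mulr1 mulr2n (addrr_pchar2 ch2) addr0 //.
have [i1 [c1 [c1_0 r1]]] := klein_representative_of rP p_in.
have [i2 [c2 [c2_0 r2]]] := klein_representative_of rP (q_in _ alpha3).
have [i3 [c3 [c3_0 r3]]] := klein_representative_of rP (q_in _ alpha2_3).
have i1q i c t : r i = c *: q t -> i1 != i.
  move=> ri; apply/eqP => i1_i; apply: (pq0 (c1^-1 * c) t).
  by rewrite -scalerA -ri -i1_i r1 scalerA mulVf ?scale1r.
have i12 := i1q _ _ _ r2; have i13 := i1q _ _ _ r3.
have i23 : i2 != i3.
  apply: contraNneq beta0 => i23; rewrite /beta.
  by rewrite -(q_eq c3 c2 alpha (alpha ^+ 2)) ?(addrr_pchar2 ch2) // -r2 i23 r3.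
(* The inverses of [c1], [c2], [c3] undo the scaling of the given representatives. *)
pose x : 'rV[F]_24 := \row_i (if i == i1 then c1^-1 * beta else
  if i == i2 then c2^-1 else if i == i3 then c3^-1 else 0).
have sum_x (V : lmodType F) (h : 'I_24 -> V) : \sum_i x 0 i *: h i =
    c1^-1 *: (beta *: h i1) + c2^-1 *: h i2 + c3^-1 *: h i3.
  rewrite (bigD1 i1) //= (bigD1 i2) 1?eq_sym //= (bigD1 i3) /=; last first.
    by rewrite ![i3 == _]eq_sym i13 i23.
  rewrite big1 => [|i /andP[/andP[i1_i i2_i] i3_i]].
    rewrite !mxE !eqxx [i2 == i1]eq_sym ![i3 == _]eq_sym.
    by rewrite (negPf i12) (negPf i13) (negPf i23) addr0 scalerA addrA.
  by rewrite mxE (negPf i1_i) (negPf i2_i) (negPf i3_i) scale0r.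
exists x.
  split.
    apply/klein_Z_orthogonal; rewrite sum_x r1 r2 r3.
    rewrite [beta *: _]scalerA mulrC -scalerA !(scalerA _^-1) !mulVf // !scale1r.
    rewrite [LHS]row3_eta -row3_0 !mxE /=; congr row3.
    - by transitivity (2%:R * beta); [rewrite /beta; ring | rewrite (pcharf0 ch2) mul0r].
    - by rewrite mulr0 add0r (addrr_pchar2 ch2).
    - by rewrite mulr0 add0r (addrr_pchar2 ch2).
  (* The logical row X Y^2 Z^5 takes the value 0 at (1, 0, 0) and t at (t, 1, 1), so the dot product
     is alpha + alpha^2 = [beta], which is nonzero. *)
  exists 0; rewrite (_ : dot _ _ = beta); first exact/eqP.
  transitivity (\sum_i x 0 i *: ((klein_monomials (r i))`_0 : F^o)).
    by apply: eq_bigr => i _; rewrite !mxE.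
  rewrite sum_x r1 r2 r3 !nth_klein_monomialsZ // /GRing.scale /= !row3E.
  by rewrite !expr1n !mulr1 !mulKf // expr0n /= mulr0 mul0r !mulr0 add0r.
rewrite /hamming_weight (_ : [set i | x 0 i != 0] = i1 |: [set i2; i3]).
  by rewrite cardsU1 cards2 !inE negb_or i12 i13 i23.
apply/setP => i; rewrite !inE mxE.
do 3?[case: ifP => _]; by rewrite ?eqxx ?mulf_neq0 ?invr_eq0.
Qed.

Theorem mainTheorem11 (F : finFieldType) (C : numClosedFieldType)
    (cardF : #|F| = 8%N) :
  (* N is CCZ up to Pauli X's and a global phase *)
  (forall b : 'I_3 -> F, F2_basis b ->
     exists2 omega : C, `|omega| = 1 &
       forall psi : state C F,
         as_qubits b (apply (norm_gate C F) psi) =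
         omega *: apply (tensor_pow (X_gate C) 3)
                    (apply (CCZ_gate C)
                      (apply (tensor_pow (X_gate C) 3) (as_qubits b psi)))) /\
  #|klein_quartic F| = 24%N /\
  forall (P : 'I_24 -> {set 'rV[F]_3}) (r : 'I_24 -> 'rV[F]_3),
    injective P -> [set P i | i : 'I_24] = klein_quartic F ->
    (forall i, r i \in P i) ->
    let G : 'M[F]_(4 + 3, 24) := klein_matrix r in
    [/\ row_free G,
        forall a b c : 'I_(4 + 3),
          \sum_i G a i ^+ 4 * G b i ^+ 2 * G c i =
          (if [&& a == b, b == c & (a < 4)%N] then 1 else 0),
        acts_as_logical_norm G C
      & Z_distance_is G 3].
Proof.
split; last split; last move=> P r inj_P imP rP G.
- by move=> b b_basis; exists (-1) => [|psi];
    [rewrite normrN1 | exact: norm_gate_CCZ].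
- exact: card_klein_quartic.
have repr : klein_representatives r by exists P.
have tri := klein_representatives_trilinear cardF repr.
split; [exact: klein_matrix_row_free | exact: tri | exact: trilinear_norm |].
by split; [exact: klein_Z_weight3 | move=> x; exact: klein_Z_weight].
Qed.
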